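(* Let $E: y^2=x^3+ax^2+bx+c$ ($a,b,c\in\mathbb{Z}$) be an elliptic curve and $P\in E(\mathbb{Q})$ a point of infinite order. For every $k\ge1$, with $F_k=F_k(E,P)$ and $\tau_k=\frac{2n_{k-1}}{F_k}$, the following hold: \[F_k=\frac{2n_{k-1}}{\tau_k},\] \[n_k=\frac{-2am_{k-1}m_ke_{k-1}^2-bm_{k-1}e_{k-1}^4F_k^2-bm_ke_{k-1}^4-2ce_{k-1}^6F_k^2+m_{k-1}^3F_k^2-3m_{k-1}^2m_k}{\tau_k},\] \[m_k=\frac{m_{k-1}^4-2bm_{k-1}^2e_{k-1}^4-8cm_{k-1}e_{k-1}^6+b^2e_{k-1}^8-4ace_{k-1}^8}{\tau_k^2},\] \[e_k=F_0F_1\cdots F_k.\]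
   Context: An elliptic curve is a non-singular cubic $y^2=x^3+ax^2+bx+c$ with $a,b,c\in\mathbb{Z}$. For $k\ge0$ write $2^kP=\left(\frac{m_k}{e_k^2},\frac{n_k}{e_k^3}\right)$ with $m_k,n_k,e_k\in\mathbb{Z}$, $e_k\ge1$, $\gcd(m_k,e_k)=\gcd(n_k,e_k)=1$. Define $F_0(E,P)=e_0$ and $F_k(E,P)=e_k/e_{k-1}$ for $k\ge1$. *)

(* Defs.v *)
From HB Require Import structures.
From mathcomp Require Import all_boot all_order all_algebra all_field.

Set Implicit Arguments.
Unset Strict Implicit.
Unset Printing Implicit Defensive.

Import Order.TTheory GRing.Theory Num.Theory.
Local Open Scope ring_scope.

(* No point of y^2 = x^3 + a x^2 + b x + c over the algebraic closure kills
   both partial derivatives; the point at infinity of such a cubic is always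
   smooth, so it needs no condition. *)
Definition nonsingular (a b c : int) : Prop :=
  forall x y : algC,
    y ^+ 2 = x ^+ 3 + a%:~R * x ^+ 2 + b%:~R * x + c%:~R ->
    ~ (2 * y = 0 /\ 3 * x ^+ 2 + 2 * a%:~R * x + b%:~R = 0).

Inductive point : Type :=
| Infinity
| Affine of rat & rat.

Definition on_curve (a b c : int) (P : point) : Prop :=
  match P with
  | Infinity => True
  | Affine x y => y ^+ 2 = x ^+ 3 + a%:Q * x ^+ 2 + b%:Q * x + c%:Q
  end.

(* Chord-and-tangent law. The coefficient c does not occur in the formulas.
   For points of the curve with x1 = x2 and y1 <> - y2 one has y1 = y2 <> 0,
   which is the tangent case. *)
Definition ec_add (a b : int) (P Q : point) : point :=
  match P, Q with
  | Infinity, _ => Q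
  | _, Infinity => P
  | Affine x1 y1, Affine x2 y2 =>
      if (x1 == x2) && (y1 == - y2) then Infinity
      else
        let l := if x1 == x2
                 then (3 * x1 ^+ 2 + 2 * a%:Q * x1 + b%:Q) / (2 * y1)
                 else (y2 - y1) / (x2 - x1) in
        let x3 := l ^+ 2 - a%:Q - x1 - x2 in
        Affine x3 (l * (x1 - x3) - y1)
  end.

Definition ec_mul (a b : int) (n : nat) (P : point) : point :=
  iter n (ec_add a b P) Infinity.

Definition infinite_order (a b : int) (P : point) : Prop :=
  forall n : nat, (0 < n)%N -> ec_mul a b n P <> Infinity.

(* Signs are pinned down by 1 <= e k, so m, n, e are determined by P. *)
Definition coordinates_2powers (a b : int) (P : point) (m n e : nat -> int)
    : Prop :=
  forall k : nat,
    [/\ ec_mul a b (2 ^ k)%N P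
          = Affine ((m k)%:Q / (e k)%:Q ^+ 2) ((n k)%:Q / (e k)%:Q ^+ 3),
        1 <= e k,
        gcdz (m k) (e k) = 1
      & gcdz (n k) (e k) = 1].

Definition Fseq (e : nat -> int) (k : nat) : rat :=
  if k is j.+1 then (e k)%:Q / (e j)%:Q else (e 0%N)%:Q.

Definition tau (n e : nat -> int) (k : nat) : rat :=
  2 * (n k.-1)%:Q / Fseq e k.

(* Main.v *)
(** The formulas are the duplication formulas for [x = m/e^2], [y = n/e^3];
    they apply because [2^k P] is the double of [2^(k-1) P].  As multiples are
    defined by repeatedly adding [P], this last fact needs associativity.  Let
    the lines of slopes [l] and [g] through [P1, P2] and [P2, P3] meet the cubic
    again above [x4] and [x5].  If [l <> g], the lines with slopes
    [(x1 - x3) / (l - g) - l] and [(x1 - x3) / (l - g) - g] through [P1 + P2, P3]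
    and [P1, P2 + P3] meet the cubic again at the same point, whether the lines
    involved are chords or tangents.  If [l = g], then [P1 = P3] or
    [P1 = - (P2 + P3)]. *)
Require Import Defs.
From HB Require Import structures.
From mathcomp Require Import all_boot all_order all_algebra all_field.
From mathcomp Require Import ring.

Set Implicit Arguments.
Unset Strict Implicit.
Unset Printing Implicit Defensive.

Import Order.TTheory GRing.Theory Num.Theory.
Local Open Scope ring_scope.

(** * Lines meeting the cubic *)

(* The coefficients of
   [X^3 + a X^2 + b X + c - (l X + v)^2 = (X - x1) (X - x2) (X - x3)]. *)
Definition meets (a b c l v x1 x2 x3 : rat) : Prop :=
  [/\ a = l ^+ 2 - x1 - x2 - x3,
      b = x1 * x2 + x1 * x3 + x2 * x3 + 2 * l * v
    & c = v ^+ 2 - x1 * x2 * x3].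

Lemma meets_swap12 a b c l v x1 x2 x3 :
  meets a b c l v x1 x2 x3 -> meets a b c l v x2 x1 x3.
Proof. by case=> -> -> ->; split; ring. Qed.

Lemma meets_swap23 a b c l v x1 x2 x3 :
  meets a b c l v x1 x2 x3 -> meets a b c l v x1 x3 x2.
Proof. by case=> -> -> ->; split; ring. Qed.

Lemma meets_on_curve (a b c : int) l v x1 x2 x3 :
  meets a%:Q b%:Q c%:Q l v x1 x2 x3 ->
  on_curve a b c (Affine x3 (- (l * x3 + v))).
Proof. by case=> /= -> -> ->; ring. Qed.

(** Chords and tangents become one relation, so that later proofs need not tell them apart. The
    first point eliminates [c]; for a chord the second point eliminates [b]. *)
Lemma ec_add_meets (a b c : int) x1 y1 x2 y2 x3 y3 :
  on_curve a b c (Affine x1 y1) -> on_curve a b c (Affine x2 y2) ->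
  ec_add a b (Affine x1 y1) (Affine x2 y2) = Affine x3 y3 ->
  exists l v, [/\ y1 = l * x1 + v, y2 = l * x2 + v, y3 = - (l * x3 + v)
                & meets a%:Q b%:Q c%:Q l v x1 x2 x3].
Proof.
rewrite /on_curve /ec_add => h1 h2.
have cE : c%:Q = y1 ^+ 2 - x1 ^+ 3 - a%:Q * x1 ^+ 2 - b%:Q * x1.
  by rewrite h1; ring.
have [ex|nx] := eqVneq x1 x2; last first.
  have d0 : x2 - x1 != 0 by rewrite subr_eq0 eq_sym.
  case=> <- <-; set l := (y2 - y1) / _.
  have bE : b%:Q = (y2 ^+ 2 - y1 ^+ 2 - x2 ^+ 3 + x1 ^+ 3
                    - a%:Q * (x2 ^+ 2 - x1 ^+ 2)) / (x2 - x1).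
    by rewrite h1 h2; field.
  exists l, (y1 - l * x1); split; [by ring | by rewrite /l; field | by ring |].
  by split; rewrite ?cE ?bE /l; [ring | field | field].
rewrite -{x2}ex in h2 *; case: eqVneq => //= ny [<- <-].
have e12 : y1 = y2.
  have /eqP : (y1 + y2) * (y1 - y2) = 0.
    by transitivity (y1 ^+ 2 - y2 ^+ 2); [ring | rewrite h1 h2; ring].
  by rewrite mulf_eq0 addr_eq0 (negPf ny) subr_eq0 => /eqP.
have y0 : y1 != 0.
  by apply: contra_neq ny; rewrite -e12 => ->; rewrite oppr0.
rewrite -e12 {h2 ny y2 e12}; set l := _ / (2 * y1).
exists l, (y1 - l * x1); split; [by ring | by ring | by ring |].
by split; rewrite ?cE /l; [ring | field | field].
Qed.

(** At a double root [x1] the cubic has derivative [2 l (l x1 + v)], so the tangent quotient gives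
    back [l]; the sum being affine makes [l x1 + v] nonzero. *)
Lemma meets_ec_add (a b c : int) l v x1 x2 x3 :
  meets a%:Q b%:Q c%:Q l v x1 x2 x3 ->
  ec_add a b (Affine x1 (l * x1 + v)) (Affine x2 (l * x2 + v)) <> Infinity ->
  ec_add a b (Affine x1 (l * x1 + v)) (Affine x2 (l * x2 + v))
    = Affine x3 (- (l * x3 + v)).
Proof.
case=> aE bE _; rewrite /ec_add.
have [ex|nx] := eqVneq x1 x2 => /=.
  rewrite -{x2}ex in aE bE *; case: eqVneq => //= ny _.
  have y0 : l * x1 + v != 0 by apply: contra_neq ny => ->; rewrite oppr0.
  have -> : (3 * x1 ^+ 2 + 2 * a%:Q * x1 + b%:Q) / (2 * (l * x1 + v)) = l.
    by rewrite aE bE; field.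
  by rewrite aE; congr Affine; ring.
move=> _; have -> : (l * x2 + v - (l * x1 + v)) / (x2 - x1) = l.
  by field; rewrite subr_eq0 eq_sym.
by rewrite aE; congr Affine; ring.
Qed.

Lemma ec_add_on_curve (a b c : int) P Q :
  on_curve a b c P -> on_curve a b c Q -> on_curve a b c (ec_add a b P Q).
Proof.
case: P Q => [|x1 y1] [|x2 y2] // h1 h2.
case E: (ec_add a b (Affine x1 y1) (Affine x2 y2)) => [//|x3 y3].
have [l [v [_ _ -> hm]]] := ec_add_meets h1 h2 E.
exact: meets_on_curve hm.
Qed.

Lemma ec_add_eq_Infinity a b x1 y1 x2 y2 :
  ec_add a b (Affine x1 y1) (Affine x2 y2) = Infinity -> x1 = x2 /\ y1 = - y2.
Proof. by rewrite /ec_add; case: ifP => // /andP[/eqP -> /eqP ->]. Qed.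

Lemma ec_addC (a b c : int) P Q :
  on_curve a b c P -> on_curve a b c Q -> ec_add a b P Q = ec_add a b Q P.
Proof.
case: P Q => [|x1 y1] [|x2 y2] // h1 h2.
have inf u1 v1 u2 v2 : ec_add a b (Affine u1 v1) (Affine u2 v2) = Infinity ->
    ec_add a b (Affine u2 v2) (Affine u1 v1) = Infinity.
  by move=> /ec_add_eq_Infinity[-> ->]; rewrite /ec_add opprK !eqxx.
case E: (ec_add a b (Affine x1 y1) (Affine x2 y2)) => [|x3 y3].
  by rewrite (inf _ _ _ _ E).
have [l [v [e1 e2 e3 /meets_swap12 hm]]] := ec_add_meets h1 h2 E.
rewrite e1 e2 e3 in E inf *; rewrite (meets_ec_add hm) // => /inf.
by rewrite E.
Qed.

(** * Associativity *)

Lemma meets_assoc (a b c l v g w x1 x2 x3 x4 x5 : rat) :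
  meets a b c l v x1 x2 x4 -> meets a b c g w x2 x3 x5 ->
  l * x2 + v = g * x2 + w -> l != g ->
  exists s u t z x6,
    [/\ meets a b c s u x4 x3 x6, meets a b c t z x1 x5 x6
      & [/\ s * x4 + u = - (l * x4 + v), s * x3 + u = g * x3 + w,
            t * x1 + z = l * x1 + v, t * x5 + z = - (g * x5 + w)
          & s * x6 + u = t * x6 + z]].
Proof.
case=> aE bE cE [aE' bE' _] e2 nlg.
have d0 : l - g != 0 by rewrite subr_eq0.
(* Equating the two expressions of [a], and then those of [b], leaves only [l], [g], [x1], [x2],
   [x3], [x5] as parameters; the claims become rational identities. *)
have x4E : x4 = l ^+ 2 - g ^+ 2 + x3 + x5 - x1.
  have -> : x4 = l ^+ 2 - x1 - x2 - a by rewrite aE; ring.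
  by rewrite aE'; ring.
have vE : v = g * x2 + w - l * x2 by rewrite -e2; ring.
have wE : w = (x2 * x3 + x2 * x5 + x3 * x5 - x1 * x2 - x1 * x4 - x2 * x4)
                / (2 * (l - g)) + l * x2.
  have h : 2 * (l - g) * w
      = x2 * x3 + x2 * x5 + x3 * x5 - x1 * x2 - x1 * x4 - x2 * x4
        + 2 * (l - g) * (l * x2).
    transitivity (b - (x1 * x2 + x1 * x4 + x2 * x4)
                  + 2 * (l - g) * (l * x2) - 2 * g * w).
      by rewrite bE vE; ring.
    by rewrite bE'; ring.
  have n0 : 2 * (l - g) != 0 by rewrite mulf_neq0.
  by apply: (mulfI n0); rewrite h; field.
(* Written over [l - g], these slopes also make sense when [x4 = x3] or [x1 = x5]. *)
pose s := (x1 - x3) / (l - g) - l; pose t := (x1 - x3) / (l - g) - g.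
exists s, (g * x3 + w - s * x3), t, (l * x1 + v - t * x1), (s ^+ 2 - a - x4 - x3).
rewrite aE bE cE vE wE x4E /s /t.
by split; [split | split | split]; field.
Qed.

Lemma ec_addA (a b c : int) P1 P2 P3 :
  on_curve a b c P1 -> on_curve a b c P2 -> on_curve a b c P3 ->
  ec_add a b P1 P2 <> Infinity -> ec_add a b P2 P3 <> Infinity ->
  ec_add a b (ec_add a b P1 P2) P3 <> Infinity ->
  ec_add a b P1 (ec_add a b P2 P3) <> Infinity ->
  ec_add a b (ec_add a b P1 P2) P3 = ec_add a b P1 (ec_add a b P2 P3).
Proof.
case: P1 P2 P3 => [|x1 y1] [|x2 y2] [|x3 y3] //; try by case: (ec_add _ _ _ _).
move=> h1 h2 h3.
case E4: (ec_add a b (Affine x1 y1) (Affine x2 y2)) => [//|x4 y4] _.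
case E5: (ec_add a b (Affine x2 y2) (Affine x3 y3)) => [//|x5 y5] _.
have [l [v [e1 e2 e4 hl]]] := ec_add_meets h1 h2 E4.
have [g [w [e2' e3 e5 hg]]] := ec_add_meets h2 h3 E5.
have e22 : l * x2 + v = g * x2 + w by rewrite -e2 -e2'.
have [elg|nlg] := eqVneq l g; last first.
  have [s [u [t [z [x6 [hs ht [f4 f3 f1 f5 f6]]]]]]] := meets_assoc hl hg e22 nlg.
  rewrite e4 e3 e1 e5 -f4 -f3 -f1 -f5 => n1 n2.
  by rewrite (meets_ec_add hs n1) (meets_ec_add ht n2) f6.
have {e22} evw : v = w by move: e22; rewrite elg => /addrI.
subst g w; move=> n1 n2.
(* Both sums now use the same line, so [x1, x4] and [x3, x5] have equal sums and equal products:
   [x1] is a root of [(X - x3) (X - x5)]. *)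
have /eqP : (x3 - x1) * (x5 - x1) = 0.
  have x4E : x4 = x3 + x5 - x1.
    case: hl hg => aE _ _ [aE' _ _].
    have -> : x4 = l ^+ 2 - x1 - x2 - a%:Q by rewrite aE; ring.
    by rewrite aE'; ring.
  case: hl hg => _ bE _ [_ bE' _].
  transitivity (b%:Q - x1 * x2 - x1 * x4 - x2 * x4 - 2 * l * v).
    by rewrite bE' x4E; ring.
  by rewrite bE; ring.
rewrite mulf_eq0 !subr_eq0 => /orP[] /eqP ex; last first.
  by case: n2; rewrite e1 e5 ex /ec_add eqxx opprK eqxx.
(* Here [P3 = P1], and the claim follows by using commutativity twice. *)
have [e31 e31'] : x3 = x1 /\ y3 = y1 by rewrite e3 e1 ex.
rewrite e31 e31' in h3 E5 *.
have <- : Affine x4 y4 = Affine x5 y5 by rewrite -E4 -E5; exact: ec_addC h1 h2.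
rewrite (ec_addC _ h1) //.
by rewrite -E4; apply: ec_add_on_curve.
Qed.

(** * Multiples of a point *)

Lemma ec_mul_on_curve (a b c : int) P n :
  on_curve a b c P -> on_curve a b c (ec_mul a b n P).
Proof. by move=> hP; elim: n => //= n; exact: ec_add_on_curve. Qed.

(** If [P + Q = - R], then [R] is the third point on the line through [P] and [Q]; that line, read
    through [P] and [R], gives [P + R = - Q]. *)
Lemma ec_add_rotate (a b c : int) P Q R :
  on_curve a b c P -> on_curve a b c Q -> on_curve a b c R ->
  ec_add a b P R <> Infinity ->
  ec_add a b P Q <> Infinity -> R <> Infinity ->
  ec_add a b (ec_add a b P Q) R = Infinity ->
  ec_add a b Q (ec_add a b P R) = Infinity.
Proof.
case: P Q R => [|x1 y1] [|x2 y2] [|x3 y3] // h1 h2 h3 n13.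
case E: (ec_add a b _ _) => [//|x4 y4] _ _.
have [l [v [e1 e2 e4 /meets_swap23 hl]]] := ec_add_meets h1 h2 E.
move=> /ec_add_eq_Infinity [e34]; rewrite e4 e34 => /oppr_inj e3.
rewrite e34 in hl; rewrite e1 -e3 in n13 *.
by rewrite (meets_ec_add hl n13) e2 /ec_add eqxx opprK eqxx.
Qed.

(** Induction on [i] through [P + (iP + jP) = (P + iP) + jP]; infinite order keeps all the sums
    affine, as [ec_addA] requires. *)
Lemma ec_mulD (a b c : int) P i j :
  on_curve a b c P -> infinite_order a b P -> (0 < i)%N -> (0 < j)%N ->
  ec_mul a b (i + j) P = ec_add a b (ec_mul a b i P) (ec_mul a b j P).
Proof.
move=> hP hinf; elim: i j => // i IH j _ j0.
have hQ k : on_curve a b c (ec_mul a b k P) by exact: ec_mul_on_curve.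
have [->|i0] := posnP i.
  by rewrite /ec_mul /=; case: (P).
have mulS k : ec_mul a b k.+1 P = ec_add a b P (ec_mul a b k P) by [].
have nS k : ec_add a b P (ec_mul a b k P) <> Infinity by exact: (hinf k.+1).
rewrite addSn !mulS IH //; symmetry; apply: (@ec_addA a b c) => //.
- by rewrite -IH //; apply: hinf; rewrite addn_gt0 i0.
(* That [(P + iP) + jP] is a multiple of [P] is not yet known; rotation turns it into [iP + (j+1)P],
   to which the induction hypothesis at [j.+1] applies. *)
- move=> inf; apply: (hinf (i + j.+1)%N); first by rewrite addnS.
  rewrite IH // mulS; apply: (@ec_add_rotate a b c) => //; exact: hinf.
- by rewrite -IH.
Qed.

(** * Duplication formulas *)

(** The tangent slope [l] satisfies [2 y l = 3 x^2 + 2 a x + b]. Multiplying [x' = l^2 - a - 2 x] by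
    [4 y^2] and [y' = l (x - x') - y] by [2 y] removes [l], and the curve equation then removes [y]
    on the right. *)
Lemma ec_double_formulas (a b c : int) x y x' y' :
  on_curve a b c (Affine x y) ->
  ec_add a b (Affine x y) (Affine x y) = Affine x' y' ->
  [/\ y != 0,
      4 * y ^+ 2 * x' = x ^+ 4 - 2 * b%:Q * x ^+ 2 - 8 * c%:Q * x
                        + b%:Q ^+ 2 - 4 * a%:Q * c%:Q
    & 2 * y * y' = - 2 * a%:Q * x * x' - b%:Q * x - b%:Q * x' - 2 * c%:Q
                   + x ^+ 3 - 3 * x ^+ 2 * x'].
Proof.
rewrite /on_curve /ec_add eqxx /= => h; case: eqVneq => //= ny [<- <-].
have y0 : y != 0 by apply: contra_neq ny => ->; rewrite oppr0.
have cE : c%:Q = y ^+ 2 - x ^+ 3 - a%:Q * x ^+ 2 - b%:Q * x by rewrite h; ring.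
by rewrite cE; split=> //; field.
Qed.

Lemma prod_Fseq (e : nat -> int) k :
  (forall i, (e i)%:Q != 0) -> \prod_(0 <= i < k.+1) Fseq e i = (e k)%:Q.
Proof.
move=> e0; elim: k => [|k IH]; first by rewrite big_nat1.
by rewrite big_nat_recr //= IH mulrC divfK.
Qed.

Theorem theorem1p6 (a b c : int) (hE : nonsingular a b c)
    (P : point) (hP : on_curve a b c P) (hinf : infinite_order a b P)
    (m n e : nat -> int) (hmne : coordinates_2powers a b P m n e)
    (k : nat) (hk : (1 <= k)%N) :
  [/\ Fseq e k = 2 * (n k.-1)%:Q / tau n e k,
      (n k)%:Q =
        (- 2 * a%:Q * (m k.-1)%:Q * (m k)%:Q * (e k.-1)%:Q ^+ 2
         - b%:Q * (m k.-1)%:Q * (e k.-1)%:Q ^+ 4 * Fseq e k ^+ 2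
         - b%:Q * (m k)%:Q * (e k.-1)%:Q ^+ 4
         - 2 * c%:Q * (e k.-1)%:Q ^+ 6 * Fseq e k ^+ 2
         + (m k.-1)%:Q ^+ 3 * Fseq e k ^+ 2
         - 3 * (m k.-1)%:Q ^+ 2 * (m k)%:Q) / tau n e k,
      (m k)%:Q =
        ((m k.-1)%:Q ^+ 4
         - 2 * b%:Q * (m k.-1)%:Q ^+ 2 * (e k.-1)%:Q ^+ 4
         - 8 * c%:Q * (m k.-1)%:Q * (e k.-1)%:Q ^+ 6
         + b%:Q ^+ 2 * (e k.-1)%:Q ^+ 8
         - 4 * a%:Q * c%:Q * (e k.-1)%:Q ^+ 8) / tau n e k ^+ 2
    & (e k)%:Q = \prod_(0 <= i < k.+1) Fseq e i].
Proof.
have e0 i : (e i)%:Q != 0.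
  by have [_ e1 _ _] := hmne i; rewrite intr_eq0 gt_eqF // (lt_le_trans _ e1).
(* The product telescopes. From here on [k] stands for the index [k - 1] of the statement. *)
rewrite prod_Fseq //; case: k hk => // k _ /=; rewrite /tau /=.
have [Ek _ _ _] := hmne k; have [ES _ _ _] := hmne k.+1.
have hc := ec_mul_on_curve (2 ^ k) hP; rewrite Ek in hc.
have k0 : (0 < 2 ^ k)%N by rewrite expn_gt0.
rewrite expnS mul2n -addnn (ec_mulD hP hinf k0 k0) Ek in ES.
have [y0 hx hy] := ec_double_formulas hc ES.
have d0 := e0 k; have f0 := e0 k.+1.
have n0 : (n k)%:Q != 0 by apply: contra_neq y0 => ->; rewrite mul0r.
move: d0 f0 n0 hx hy {y0 hc ES Ek hmne}.
move: (e k)%:Q (e k.+1)%:Q (n k)%:Q (n k.+1)%:Q (m k)%:Q (m k.+1)%:Q.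
move=> d f p q r s d0 f0 p0 hx hy.
split=> //; first by field; rewrite d0 f0 p0.
(* Expanding [q] exposes the left side [2 y y'] of [hy]; below, [s] is expanded to expose
   [4 y^2 x']. *)
- have -> : q = 2 * (p / d ^+ 3) * (q / f ^+ 3) * f ^+ 3 / (2 * (p / d ^+ 3)).
    by field; rewrite d0 f0 p0.
  by rewrite hy; field; rewrite d0 f0 p0.
- have -> : s = 4 * (p / d ^+ 3) ^+ 2 * (s / f ^+ 2) * f ^+ 2
                / (4 * (p / d ^+ 3) ^+ 2).
    by field; rewrite d0 f0 p0.
  by rewrite hx; field; rewrite d0 f0 p0.
Qed.
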